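(* For every four-edge path $P$ in a convex geometric graph that is not a zigzag path, ${\rm ex}_{\circlearrowright}(n,P)=\Omega(n\log\log n)$ as $n\to\infty$.
   Context: A convex geometric (cg) graph is a graph whose vertex set is cyclically ordered (vertices are points on a convex closed curve $\Omega$, edges drawn as chords); an $n$-vertex cg graph has vertex set $[n]$ with its natural cyclic order. A cg graph $F$ is contained in a cg graph $G$ if there is an injective map $V(F)\to V(G)$ preserving the cyclic order and mapping edges to edges; ${\rm ex}_{\circlearrowright}(n,F)$ is the maximum number of edges of an $n$-vertex cg graph not containing $F$. Two edges cross if their endpoints are four distinct vertices interleaving in the cyclic order. The cyclic chromatic number $\chi_c$ of a cg graph is the least $m$ such that its vertex set can be partitioned into $m$ disjoint arcs (intervals of the cyclic order) with no edge having both endpoints in the same arc. A path $x_1x_2\dots x_s$ in a cg graph is a zigzag path if no two of its edges cross and, for every $2\le j\le s-2$, the sets $\{x_1,\dots,x_{j-1}\}$ and $\{x_{j+2},\dots,x_s\}$ lie on different sides of the chord $x_jx_{j+1}$; equivalently, it has no crossing and cyclic chromatic number $2$. *)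

(* Defs.v *)
From mathcomp Require Import all_boot.

Set Implicit Arguments.
Unset Strict Implicit.
Unset Printing Implicit Defensive.

(* Going clockwise from a, one meets b strictly before c, and c strictly before
   coming back to a; in particular a, b, c are pairwise distinct. Equivalently,
   b lies strictly on one fixed side of the chord ac. *)
Definition cyc n (a b c : 'I_n) : bool :=
  [|| a < b < c, b < c < a | c < a < b].

(* An n-vertex convex geometric graph, given by its set of edges. The vertex
   set 'I_n carries the cyclic order cyc. *)
Definition cg_graph n := {E : {set {set 'I_n}} | [forall e in E, #|e| == 2]}.

Definition edges n (G : cg_graph n) : {set {set 'I_n}} := val G.

Definition adj n (G : cg_graph n) (u v : 'I_n) : bool :=
  [set u; v] \in edges G.

Definition cg_embedding k n (F : cg_graph k) (G : cg_graph n)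
    (f : {ffun 'I_k -> 'I_n}) : bool :=
  [&& injectiveb f,
      [forall a, forall b, forall c, cyc a b c ==> cyc (f a) (f b) (f c)] &
      [forall a, forall b, adj F a b ==> adj G (f a) (f b)]].

Definition cg_contains k n (G : cg_graph n) (F : cg_graph k) : bool :=
  [exists f : {ffun 'I_k -> 'I_n}, cg_embedding F G f].

Definition ex_cg n k (F : cg_graph k) : nat :=
  \max_(G : cg_graph n | ~~ cg_contains G F) #|edges G|.

(* The chords ab and cd cross: c and d lie strictly on different sides of ab. *)
Definition crossing n (a b c d : 'I_n) : bool :=
  (cyc a c b && cyc b d a) || (cyc a d b && cyc b c a).

Definition noncrossing n (G : cg_graph n) : Prop :=
  forall a b c d, adj G a b -> adj G c d -> ~~ crossing a b c d.

(* G is the spanning path x_0 x_1 ... x_{s-1} on its s vertices. *)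
Definition path_along s (G : cg_graph s) (x : 'I_s -> 'I_s) : Prop :=
  injective x /\
  edges G = [set [set x p.1; x p.2] | p : 'I_s * 'I_s & p.2 == p.1.+1 :> nat].

Definition is_path s (G : cg_graph s) : Prop :=
  exists x : 'I_s -> 'I_s, path_along G x.

(* All vertices of A are on one open side of the chord ab, and all vertices of
   B on the other. *)
Definition separated_by n (a b : 'I_n) (A B : {set 'I_n}) : Prop :=
  [/\ forall u, u \in A -> cyc a u b & forall v, v \in B -> cyc b v a] \/
  [/\ forall u, u \in A -> cyc b u a & forall v, v \in B -> cyc a v b].

(* Indices start at 0 here: the chord x_j x_{j+1} ranges over the edges that
   have at least one path vertex before and one after them. *)
Definition zigzag_path s (G : cg_graph s) : Prop :=
  noncrossing G /\
  exists x : 'I_s -> 'I_s, path_along G x /\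
    forall j j' : 'I_s, j' = j.+1 :> nat -> 0 < j -> j'.+1 < s ->
      separated_by (x j) (x j') [set x i | i : 'I_s & i < j]
                                [set x i | i : 'I_s & j' < i].

(* Main.v *)
Require Import Defs.
From mathcomp Require Import all_boot all_order all_algebra.
From mathcomp Require Import all_classical all_reals all_analysis.
From mathcomp Require Import zify lra.
Import numFieldNormedType.Exports.
Set Implicit Arguments.
Unset Strict Implicit.
Unset Printing Implicit Defensive.

(* A cyclic embedding of the path becomes, after rotating its labels, an
   increasing map into 0 < 1 < ... < n - 1, so it suffices to exhibit dense
   graphs on the integers that avoid every rotation of the path.  Up to
   reflection three graphs are enough.
   - The pentagram paths are avoided by the edges whose difference is a power
     of 2.
   - Every other path is avoided by a graph with edges between a left and a
     right half, unless its own vertices split into two arcs with all edges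
     between them.  If they do and the path is not a zigzag, then up to
     reflection its cyclic order is x3 x1 x5 x2 x4 or x3 x5 x1 x2 x4.
   - The first order is avoided by the bipartite graph whose edge sums are
     n - 2^k.
   - For the second, the right half is placed at offset h and an edge joins a
     to h + a + 2K 2^k + k whenever the colour a mod 2K equals k + 4^i < K.
     The jumps grow like 2^k, which rules out the copies with two vertices on
     the right.  In the copies with two vertices on the left, both colours are
     tied by the common neighbour: phi + k = phi' + k'.  This forces the next
     jump of the second vertex to exceed every jump of the first.
   With K about log n there are about log K values of i, hence about
   n log log n edges.  The remaining finite case distinction over the 120
   labelled paths is computed. *)

(** * Host graphs on the integers and increasing copies of the path *)

Definition joined (E : rel nat) (v : nat -> nat) : rel nat :=
  fun a b => if a < b then E (v a) (v b) else E (v b) (v a).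

(* q lists the positions, among the five increasing host vertices v 0, ..., v 4,
   of the successive vertices of the path. *)
Definition avoids n (E : rel nat) (q : seq nat) : Prop :=
  forall v : nat -> nat, v 0 < v 1 < v 2 -> v 2 < v 3 < v 4 -> v 4 < n ->
  ~~ sorted (joined E v) q.

Definition rotation (s : nat) (p : seq nat) := [seq (a + s) %% 5 | a <- p].

Definition path_code (x : 'I_5 -> 'I_5) : seq nat :=
  [seq val (x i) | i <- enum 'I_5].

Section Host.
Variables (n : nat) (E : rel nat).

Definition host_edges : {set {set 'I_n}} :=
  [set [set c.1; c.2] | c : 'I_n * 'I_n & (c.1 < c.2) && E c.1 c.2].

Lemma host_edgesP : [forall e in host_edges, #|e| == 2].
Proof.
apply/forall_inP => e /imsetP[[a b]]; rewrite inE /= => /andP[ab _] ->.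
by rewrite cards2; case: (eqVneq a b) ab => // ->; rewrite ltnn.
Qed.

Definition host : cg_graph n := exist _ host_edges host_edgesP.

Lemma adj_host (a b : 'I_n) :
  adj host a b = ((a < b) && E a b) || ((b < a) && E b a).
Proof.
apply/imsetP/orP => [[[c d]]|[] abE]; last 2 first.
- by exists (a, b); rewrite ?inE.
- by exists (b, a); rewrite ?inE //= finset.setUC.
rewrite inE /= => cdE eq_ab.
have neq_cd : c != d by case: (eqVneq c d) cdE => // ->; rewrite ltnn.
have : c \in [set a; b] by rewrite eq_ab set21.
have : d \in [set a; b] by rewrite eq_ab set22.
rewrite !inE => /orP[]/eqP dE /orP[]/eqP cE; move: neq_cd cdE;
  by rewrite dE cE ?eqxx // => _ ?; first [by left | by right].
Qed.

End Host.

(** Four cyclic triples fix the cyclic order of the five images; [s] is the label with the smallest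
    image. *)
Lemma cyclic_increasing n (f : {ffun 'I_5 -> 'I_n}) :
  (forall a b c, cyc a b c -> cyc (f a) (f b) (f c)) ->
  exists2 s, s < 5 &
    let v j := val (f (inord ((j + s) %% 5))) in
    (v 0 < v 1 < v 2) && (v 2 < v 3 < v 4).
Proof.
move=> cycf.
pose y a : nat := f (inord a).
have cycy a b c : a < b -> b < c -> c < 5 ->
    [|| y a < y b < y c, y b < y c < y a | y c < y a < y b].
  move=> ab bc c5; apply: cycf; rewrite /cyc !inordK ?ab ?bc //; lia.
have := cycy 0 1 2 isT isT isT; have := cycy 0 2 3 isT isT isT.
have := cycy 0 3 4 isT isT isT; have := cycy 1 2 3 isT isT isT.
rewrite /= => c1 c2 c3 c4.
suff : [|| (y 0 < y 1 < y 2) && (y 2 < y 3 < y 4),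
           (y 1 < y 2 < y 3) && (y 3 < y 4 < y 0),
           (y 2 < y 3 < y 4) && (y 4 < y 0 < y 1),
           (y 3 < y 4 < y 0) && (y 0 < y 1 < y 2) |
           (y 4 < y 0 < y 1) && (y 1 < y 2 < y 3)].
  by case/or4P=> [|||/orP[]] h;
     [exists 0|exists 1|exists 2|exists 3|exists 4] => //.
move: c1 c2 c3 c4; move: (y 0) (y 1) (y 2) (y 3) (y 4) => *; lia.
Qed.

Lemma nth_path_code x i : i < 5 -> nth 0 (path_code x) i = x (inord i).
Proof.
move=> lti; have sz : size (enum 'I_5) = 5 by rewrite size_enum_ord.
rewrite /path_code (nth_map (inord i)) ?sz //.
by congr (val (x _)); apply: val_inj; rewrite /= nth_enum_ord ?inordK.
Qed.

Lemma size_path_code x : size (path_code x) = 5.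
Proof. by rewrite size_map size_enum_ord. Qed.

Lemma nth_rotation s x i : i < 5 ->
  nth 0 (rotation s (path_code x)) i = (x (inord i) + s) %% 5.
Proof. by move=> lti; rewrite (nth_map 0) ?size_path_code // nth_path_code. Qed.

Lemma path_along_adj (P : cg_graph 5) x (i : nat) : path_along P x -> i < 4 ->
  adj P (x (inord i)) (x (inord i.+1)).
Proof.
move=> [_ edgesP] lti; rewrite /adj edgesP; apply/imsetP.
exists (inord i, inord i.+1) => //; rewrite inE /= !inordK //; lia.
Qed.

Lemma increasing5 (v : nat -> nat) a b : v 0 < v 1 < v 2 -> v 2 < v 3 < v 4 ->
  a < b < 5 -> v a < v b.
Proof.
move=> h1 h2 /andP[]; case: b => [|[|[|[|[|//]]]]];
  by case: a => [|[|[|[|//]]]] // _ _; lia.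
Qed.

Lemma contains_rotation n E (P : cg_graph 5) x :
  path_along P x -> cg_contains (host n E) P ->
  exists2 s, s < 5 & ~ avoids n E (rotation s (path_code x)).
Proof.
move=> Px /existsP[f /and3P[_ cycf adjf]].
have /cyclic_increasing[s s5 /= /andP[v012 v234]] :
    forall a b c, cyc a b c -> cyc (f a) (f b) (f c).
  move=> a b c.
  by move: cycf => /forallP/(_ a)/forallP/(_ b)/forallP/(_ c)/implyP.
pose v j : nat := f (inord ((j + s) %% 5)).
(* Label [a] sits at position [a - s] modulo 5; the reduction turns 5 into 0 when [s = 0]. *)
exists ((5 - s) %% 5); first by rewrite ltn_mod.
have vK (a : 'I_5) : v ((a + (5 - s) %% 5) %% 5) = f a.
  rewrite /v modnDml addnAC modnDmr -addnA subnKC ?modnDr ?modn_small //.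
    by rewrite inord_val.
  exact: ltnW.
move=> /(_ v v012 v234 (ltn_ord _))/negP; apply.
apply/(sortedP 0) => i; rewrite size_map size_path_code => lti.
rewrite !nth_rotation ?(ltnW lti) //.
set a := x _; set b := x _.
have : adj (host n E) (f a) (f b).
  have := path_along_adj Px lti; rewrite -/a -/b.
  by move: adjf => /forallP/(_ a)/forallP/(_ b)/implyP.
rewrite adj_host /joined -!vK.
set a' := (a + _) %% 5; set b' := (b + _) %% 5.
have a'5 : a' < 5 by rewrite ltn_mod.
have b'5 : b' < 5 by rewrite ltn_mod.
have incr a1 b1 := @increasing5 v a1 b1 v012 v234.
case: (ltngtP a' b') => [ab|ba|->]; last by rewrite ltnn.
- have := incr a' b'; rewrite ab b'5 => /(_ isT) vab.
  by rewrite vab ltnNge (ltnW vab) orbF.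
- have := incr b' a'; rewrite ba a'5 => /(_ isT) vba.
  by rewrite vba ltnNge (ltnW vba).
Qed.

Lemma ex_cg_host n E (P : cg_graph 5) x : path_along P x ->
  (forall s, s < 5 -> avoids n E (rotation s (path_code x))) ->
  #|edges (host n E)| <= ex_cg n P.
Proof.
move=> Px avoidE; apply: leq_bigmax_cond; apply/negP.
by move=> /(contains_rotation Px)[s /avoidE].
Qed.

(** * Graphs given by indexed chords *)

Section Chords.
Variables (I : finType) (u w : I -> nat).

Definition chords : rel nat := fun a b => [exists i, (u i == a) && (w i == b)].

Lemma chordsP a b : reflect (exists2 i, u i = a & w i = b) (chords a b).
Proof.
apply: (iffP existsP) => [[i /andP[/eqP ua /eqP wb]]|[i ua wb]]; exists i => //.
by rewrite ua wb !eqxx.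
Qed.

(** Since [u i < w i], the unordered edge determines both endpoints in order, so distinct indices
    give distinct edges. *)
Lemma card_chords n : (forall i, u i < w i < n) ->
  (forall i j, u i = u j -> w i = w j -> i = j) ->
  #|I| <= #|edges (host n chords)|.
Proof.
case: n => [|n] uwn inj_uw.
  by have /eq_card0-> : I =i pred0 by move=> i; have := uwn i; lia.
have e_inj :
    injective (fun i => [set inord (u i); inord (w i)] : {set 'I_n.+1}).
  move=> i j eq_ij.
  have /andP[ui wi] := uwn i; have /andP[uj wj] := uwn j.
  have : (inord (u i) : 'I_n.+1) \in [set inord (u j); inord (w j)].
    by rewrite -eq_ij set21.
  have : (inord (w i) : 'I_n.+1) \in [set inord (u j); inord (w j)].
    by rewrite -eq_ij set22.
  rewrite !inE -!val_eqE /= !inordK; try lia.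
  by move=> ? ?; apply: inj_uw; lia.
rewrite -(card_imset _ e_inj); apply: subset_leq_card.
apply/fintype.subsetP => _ /imsetP[i _ ->]; apply/imsetP.
exists (inord (u i), inord (w i)) => //; have /andP[uw wn] := uwn i.
rewrite inE /= !inordK ?uw ?(ltn_trans uw) //.
by apply/chordsP; exists i.
Qed.

End Chords.

(** * Path reversal and inseparable paths *)

Lemma rev_path E v q : sorted (joined E v) (rev q) = sorted (joined E v) q.
Proof.
rewrite rev_sorted; case: q => //= a q; apply: eq_path => b c.
by rewrite /joined; case: ltngtP => // ->.
Qed.

Lemma avoids_rev n E q : avoids n E (rev q) -> avoids n E q.
Proof. by move=> avq v v1 v2 vn; rewrite -rev_path; apply: avq. Qed.

Definition separable q :=
  has (fun t => sorted (fun a b => (a < t) != (b < t)) q) (iota 0 6).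

(** The number [t] of copy vertices below [h] would be a separating cut of [q]. *)
Lemma avoids_inseparable n (E : rel nat) h q :
  (forall a b, E a b -> a < h <= b) -> all (ltn^~ 5) q -> ~~ separable q ->
  avoids n E q.
Proof.
move=> bipE q5 /negP sep_q v v012 v234 _; apply/negP => Eq; apply: sep_q.
have [t t6 vt] : exists2 t, t < 6 & forall a, a < 5 -> (a < t) = (v a < h).
  pose T t := t < 6 /\ forall a, a < 5 -> (a < t) = (v a < h).
  suff : [\/ T 0, T 1 | [\/ T 2, T 3 | T 4 \/ T 5]].
    by move=> [|| [||[]]] [];
       [exists 0|exists 1|exists 2|exists 3|exists 4|exists 5].
  have split5 (R : nat -> Prop) :
      R 0 -> R 1 -> R 2 -> R 3 -> R 4 -> forall a, a < 5 -> R a.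
    by move=> ? ? ? ? ?; do 5?case=> //.
  have [h0|h0] := leqP h (v 0).
    by constructor 1; split=> //; apply: split5; lia.
  have [h1|h1] := leqP h (v 1).
    by constructor 2; split=> //; apply: split5; lia.
  constructor 3.
  have [h2|h2] := leqP h (v 2).
    by constructor 1; split=> //; apply: split5; lia.
  have [h3|h3] := leqP h (v 3).
    by constructor 2; split=> //; apply: split5; lia.
  constructor 3.
  by have [h4|h4] := leqP h (v 4); [left|right]; split=> //; apply: split5; lia.
apply/hasP; exists t; first by rewrite mem_iota.
apply: sub_in_sorted Eq; last exact: q5.
by move=> a b a5 b5; rewrite /joined !vt //; case: ifP => _ /bipE; lia.
Qed.

(** * The three constructions for the remaining orders *)

Lemma expn_gap b i j : 1 < b -> b ^ i < b ^ j -> b * b ^ i <= b ^ j.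
Proof. by move=> b1; rewrite ltn_exp2l // -expnS leq_exp2l. Qed.

Definition pentagram_paths : seq (seq nat) :=
  [:: [:: 0; 2; 4; 1; 3]; [:: 2; 4; 1; 3; 0]; [:: 4; 1; 3; 0; 2];
      [:: 1; 3; 0; 2; 4]; [:: 3; 0; 2; 4; 1]].

(** An edge properly containing another is at least twice as long. In the first four codes, 03 or 14
    is covered by two shorter overlapping edges, which is impossible. In the last, 03 over 02 and 14
    over 24 give v3 - v2 >= v2 - v0 > v2 - v1 >= v4 - v2 > v3 - v2. *)
Lemma avoids_power_difference n (E : rel nat) q :
  (forall a b, E a b -> exists k, b = a + 2 ^ k) -> q \in pentagram_paths ->
  avoids n E q.
Proof.
move=> dyE q_in v /andP[v01 v12] /andP[v23 v34] _; apply/negP.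
have gap k l : (2 ^ k <= 2 ^ l) || (2 * 2 ^ l <= 2 ^ k).
  by case: leqP => // /(expn_gap (isT : 1 < 2)).
move: q_in; rewrite !inE; case/or4P => [|||/orP[]] /eqP->;
  rewrite /= /joined /= andbT; case/and4P=>
    /dyE[k1 e1] /dyE[k2 e2] /dyE[k3 e3] /dyE[k4 e4];
  have := gap k1 k2; have := gap k2 k3; have := gap k3 k4;
  have := gap k2 k1; have := gap k3 k2; have := gap k4 k3;
  move: (2 ^ k1) (2 ^ k2) (2 ^ k3) (2 ^ k4) e1 e2 e3 e4 => *; lia.
Qed.

(* The cyclic order x3 x1 x5 x2 x4, read from x3 and from x2. *)
Definition power_sum_paths : seq (seq nat) :=
  [:: [:: 1; 3; 0; 4; 2]; [:: 3; 0; 2; 1; 4]].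

(** Let p_ab be the power at edge ab. In the first code p_03 >= p_13 + p_04, so N <= v1 + v4, but
    edge 24 gives N > v2 + v4. In the second p_02 >= p_03 + p_12, so N <= v1 + v3, but edge 14 gives
    N > v1 + v4. *)
Lemma avoids_power_sum n (E : rel nat) h N q :
  (forall a b, E a b -> a < h <= b /\ exists k, a + b + 2 ^ k = N) ->
  q \in power_sum_paths -> avoids n E q.
Proof.
move=> dyE q_in v /andP[v01 v12] /andP[v23 v34] _; apply/negP.
have gap k l : (2 ^ k <= 2 ^ l) || (2 * 2 ^ l <= 2 ^ k).
  by case: leqP => // /(expn_gap (isT : 1 < 2)).
move: q_in; rewrite !inE; case/orP => /eqP->;
  rewrite /= /joined /= andbT; case/and4P=>
    /dyE[_ [k1 e1]] /dyE[_ [k2 e2]] /dyE[_ [k3 e3]] /dyE[_ [k4 e4]];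
  have := gap k1 k2; have := gap k2 k3; have := gap k3 k4;
  have := gap k2 k1; have := gap k3 k2; have := gap k4 k3;
  move: (2 ^ k1) (2 ^ k2) (2 ^ k3) (2 ^ k4) e1 e2 e3 e4 => *; lia.
Qed.

(* The cyclic order x3 x5 x1 x2 x4, read from x2 and from x3. *)
Definition coloured_jump_paths : seq (seq nat) :=
  [:: [:: 4; 0; 2; 1; 3]; [:: 2; 3; 0; 4; 1]].

Section ColouredJump.
Variables (K h : nat).

(** Congruent to [k] modulo [K.*2], yet geometrically growing: the residue acts on colours, the size
    on positions. *)
Definition jump k := K.*2 * 2 ^ k + k.

Lemma leq_jump k l : (jump k <= jump l) = (k <= l).
Proof.
apply: (leq_mono (f := jump)) => i j ij; rewrite /jump -addnS leq_add //.
by rewrite leq_mul2l leq_exp2l ?(ltnW ij) // orbT.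
Qed.

Lemma ltn_jump k l : (jump k < jump l) = (k < l).
Proof. by rewrite !ltnNge leq_jump. Qed.

(** The left side is at most twice [jump (l - 1)], which is [jump l + l - 2]; the excess is below
    [K.*2 <= jump k1]. *)
Lemma jump_convex k1 k l1 l : k < l -> l1 < l -> l <= K ->
  jump k + jump l1 <= jump l + jump k1.
Proof.
case: l => // l kl l1l lK.
have : jump k <= jump l by rewrite leq_jump.
have : jump l1 <= jump l by rewrite leq_jump.
have : jump l.+1 = jump l + K.*2 * 2 ^ l + 1 by rewrite /jump expnS; lia.
have : K.*2 <= jump k1.
  by rewrite /jump (leq_trans _ (leq_addr _ _)) // leq_pmulr // expn_gt0.
have : jump l = K.*2 * 2 ^ l + l by [].
lia.
Qed.

(** Colours stay below [K] so that adding [k] does not wrap around modulo [K.*2]. *)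
Definition coloured_jump a b := exists k i,
  [/\ a %% K.*2 = k + 4 ^ i, k + 4 ^ i < K & b = h + a + jump k].

Variables (n : nat) (E : rel nat).
Hypothesis jumpE : forall a b, E a b -> coloured_jump a b.

Lemma avoids_coloured_jump q : q \in coloured_jump_paths -> avoids n E q.
Proof.
move=> q_in v /andP[v01 v12] /andP[v23 v34] _; apply/negP.
move: q_in; rewrite !inE; case/orP => /eqP->;
  rewrite /= /joined /= andbT; case/and4P=>
    /jumpE[k1 [i1 [c1 l1 e1]]] /jumpE[k2 [i2 [c2 l2 e2]]]
    /jumpE[k3 [i3 [c3 l3 e3]]] /jumpE[k4 [i4 [c4 l4 e4]]].
- have k32 : k3 < k2 by rewrite -ltn_jump; lia.
  have k21 : k2 < k1 by rewrite -ltn_jump; lia.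
  have k34 : k3 < k4 by rewrite -ltn_jump; lia.
  have k41 : k4 < k1 by rewrite -ltn_jump; lia.
  have gap i j : 4 ^ i < 4 ^ j -> 4 * 4 ^ i <= 4 ^ j by apply: expn_gap.
  have colour a k i : a %% K.*2 = k + 4 ^ i -> k + 4 ^ i < K ->
      (a + jump k) %% K.*2 = k + 4 ^ i + k.
    move=> ca lt_K; rewrite /jump addnCA mulnC modnMDl -modnDml ca.
    by rewrite modn_small //; lia.
  have same : k2 + 4 ^ i2 + k2 = k3 + 4 ^ i3 + k3.
    by rewrite -(colour _ _ _ c2 l2) -(colour _ _ _ c3 l3); congr (_ %% _); lia.
  (* Contradiction with [k41]: k1 < k2 + 4^i2 = k3 + (4^i3 + 4^i2)/2 <= k3 + (5/8) 4^i3 < k3 + (3/4)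
     4^i3 <= k4. Base 4 provides the gap between 5/8 and 3/4. *)
  have : 0 < 4 ^ i1 by rewrite expn_gt0.
  have := gap i2 i3; have := gap i4 i3.
  move: (4 ^ i1) (4 ^ i2) (4 ^ i3) (4 ^ i4) c1 c2 c3 c4 l1 l2 l3 l4 same => *.
  lia.
- have k12 : k1 < k2 by rewrite -ltn_jump; lia.
  have k23 : k2 < k3 by rewrite -ltn_jump; lia.
  have k43 : k4 < k3 by rewrite -ltn_jump; lia.
  (* Here [jump k2 + jump k4] exceeds [jump k3 + jump k1] by [v 2 - v 1 > 0]. *)
  have := @jump_convex k1 k2 k4 k3 k23 k43; lia.
Qed.

End ColouredJump.

(** * Reflection of the line *)

Definition flip (q : seq nat) := [seq 4 - a | a <- q].

Lemma avoids_flip n (I : finType) (u w : I -> nat) q :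
  (forall i, u i < w i < n) -> all (ltn^~ 5) q ->
  avoids n (chords u w) (flip q) ->
  avoids n (chords (fun i => n.-1 - w i) (fun i => n.-1 - u i)) q.
Proof.
move=> uwn q5 avq v v012 v234 v4n; apply/negP => Eq.
have vn a : a < 5 -> v a < n.
  rewrite ltnS leq_eqVlt => /orP[/eqP-> //|a4].
  by apply: ltn_trans v4n; apply: increasing5; rewrite ?a4.
have := avq (fun j => n.-1 - v (4 - j)).
rewrite /= ?subSS ?subn0 ?subnn.
have v0n := vn 0 isT; have v1n := vn 1 isT; have v2n := vn 2 isT.
have v3n := vn 3 isT.
move=> /(_ ltac:(lia) ltac:(lia) ltac:(lia))/negP; apply.
rewrite sorted_map; apply: sub_in_sorted Eq; last exact: q5.
move=> a b a5 b5; have an := vn a a5; have bn := vn b b5.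
rewrite /joined /= !subKn; do ?[exact: a5|exact: b5].
have -> : (4 - a < 4 - b) = (b < a) by move: a5 b5; rewrite /in_mem /=; lia.
have flipE c d : v c < n -> v d < n ->
    chords (fun i => n.-1 - w i) (fun i => n.-1 - u i) (v c) (v d) ->
    chords u w (n.-1 - v d) (n.-1 - v c).
  move=> cn dn /chordsP[i wi ui]; apply/chordsP; exists i; have := uwn i; lia.
case: (ltngtP a b) => [_|_|<-]; exact: flipE.
Qed.

(** * Computable zigzag test and classification of paths *)

Definition cyc_code (a b c : nat) := [|| a < b < c, b < c < a | c < a < b].

Definition crossing_code a b c d :=
  (cyc_code a c b && cyc_code b d a) || (cyc_code a d b && cyc_code b c a).

(** [es] holds each edge in both orientations; 1 and 2 index the edges with path vertices before and
    after them. *)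
Definition zigzag_code (p : seq nat) :=
  let x := nth 0 p in
  let es := zip p (behead p) ++ zip (behead p) p in
  let side j := all (fun i => cyc_code (x j) (x i) (x j.+1)) in
  let other_side j := all (fun i => cyc_code (x j.+1) (x i) (x j)) in
  all (fun e => all (fun f => ~~ crossing_code e.1 e.2 f.1 f.2) es) es &&
  all (fun j => let before := iota 0 j in let after := iota j.+2 (3 - j) in
         side j before && other_side j after ||
         other_side j before && side j after)
      [:: 1; 2].

Lemma path_codeE x : path_code x =
  [:: val (x (inord 0)); val (x (inord 1)); val (x (inord 2));
      val (x (inord 3)); val (x (inord 4))].
Proof.
apply: (@eq_from_nth _ 0); first by rewrite size_path_code.
by rewrite size_path_code => -[|[|[|[|[|]]]]] // i5; rewrite nth_path_code.
Qed.

Lemma zigzag_codeP (P : cg_graph 5) x :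
  path_along P x -> zigzag_code (path_code x) -> zigzag_path P.
Proof.
move=> Px /andP[/allP nocross /allP sides]; split.
  set es := _ ++ _ in nocross.
  have adj_es a b : adj P a b -> (val a, val b) \in es.
    have es_x (i j : 'I_5) : j = i.+1 :> nat ->
        ((val (x i), val (x j)) \in es) && ((val (x j), val (x i)) \in es).
      have [i' j'] : i = inord i /\ j = inord j by rewrite !inord_val.
      rewrite i' j' !inordK //.
      move: (val i) (val j) (ltn_ord j) => {i j i' j'} k _ /[swap] ->.
      by rewrite /es path_codeE; case: k => [|[|[|[|]]]] // _;
         rewrite !inE /= !eqxx ?orbT.
    rewrite /adj (proj2 Px) => /imsetP[[i j]]; rewrite inE /= => /eqP ij eq_ab.
    have /andP[es1 es2] := es_x _ _ ij.
    have neq_x : x i != x j.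
      by apply/eqP => /(proj1 Px) eq_ij; move: ij; rewrite eq_ij; lia.
    have : x i \in [set a; b] by rewrite eq_ab set21.
    have : x j \in [set a; b] by rewrite eq_ab set22.
    rewrite !inE => /orP[]/eqP xj /orP[]/eqP xi; move: neq_x es1 es2;
      by rewrite xi xj ?eqxx.
  move=> a b c d /adj_es/nocross/allP + /adj_es => /[apply].
  by [].
exists x; split=> // j j' jj' j0 j'5.
have xE (i : 'I_5) : val (x i) = nth 0 (path_code x) i.
  by rewrite nth_path_code ?inord_val.
have before (i : 'I_5) : i < j -> (i : nat) \in iota 0 j by rewrite mem_iota.
have after (i : 'I_5) : j' < i -> (i : nat) \in iota j.+2 (3 - j).
  by have := ltn_ord i; rewrite mem_iota; lia.
have /sides/orP : (j : nat) \in [:: 1; 2] by rewrite !inE; lia.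
by case=> /andP[/allP h1 /allP h2]; [left | right];
  split=> _ /imsetP[i + ->]; rewrite inE => ij; rewrite /cyc !xE jj';
  do [apply/h1|apply/h2]; auto.
Qed.

Definition pentagram_free q :=
  (q \in pentagram_paths) || (rev q \in pentagram_paths).

Definition bipartite_free (L : seq (seq nat)) q :=
  [|| ~~ separable q, q \in L | rev q \in L].

(** One host graph must avoid all five rotations. The pentagram family is closed under reflection up
    to reversal, so only the bipartite families need [flip]. *)
Lemma classification :
  all (fun p => zigzag_code p || has (fun a : pred (seq nat) =>
    all (fun s => a (rotation s p)) (iota 0 5))
    [:: pentagram_free;
        bipartite_free power_sum_paths; bipartite_free power_sum_paths \o flip;
        bipartite_free coloured_jump_paths;
        bipartite_free coloured_jump_paths \o flip])
  (permutations (iota 0 5)).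
Proof. by vm_compute. Qed.

(** * Edge counts of the constructions *)

Lemma leq_expn_half i s : i < s./2 -> 4 ^ i <= 2 ^ s.
Proof. by move=> lt_is; rewrite -[4]/(2 ^ 2) -expnM leq_exp2l //; lia. Qed.

(** Endpoint functions are kept explicit so that the same data also yield the reflected graph. *)
Definition rich_bipartite n B (L : seq (seq nat)) :=
  exists (I : finType) (u w : I -> nat),
  [/\ forall i, u i < w i < n,
      forall i j, u i = u j -> w i = w j -> i = j,
      forall a b, chords u w a b -> a < n %/ 2 <= b,
      forall q, q \in L -> avoids n (chords u w) q &
      B <= #|I|].

(* With 2K = 2 ^ t: the number of multiples of 2K below n / 4, of values of k,
   and of values of i. *)
Definition edge_bound n t := n %/ 4 %/ 2 ^ t * 2 ^ (t - 2) * (t - 2)./2.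

Section EdgeCount.
Variables (n t : nat).
Let l := trunc_log 2 n.
Hypothesis t_def : t = trunc_log 2 l.
Hypothesis t_ge5 : 5 <= t.

Let K := 2 ^ t.-1.
Lemma log_gt0 : 0 < l.
Proof. by rewrite lt0n; apply: contraTneq t_ge5 => l0; rewrite t_def l0. Qed.

Lemma n_gt0 : 0 < n.
Proof. by rewrite lt0n; apply: contraTneq log_gt0 => n0; rewrite /l n0. Qed.

Lemma leq_pow_log : 2 ^ l <= n. Proof. exact: trunc_logP n_gt0. Qed.

Lemma leq_pow_loglog : 2 ^ t <= l.
Proof. by rewrite t_def; exact: trunc_logP log_gt0. Qed.

Lemma double_K : K.*2 = 2 ^ t.
Proof. by rewrite -mul2n -expnS prednK //; lia. Qed.

Lemma quarter_ge : 2 ^ (l - 2) <= n %/ 4.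
Proof.
rewrite leq_divRL // -(expnD 2 _ 2) subnK ?leq_pow_log //.
by rewrite (leq_trans _ leq_pow_loglog) // -[2]/(2 ^ 1) leq_exp2l //; lia.
Qed.

(** A jump is at most 2^(t + k + 1), and [k < 2 ^ (t - 2)] with 2^t <= l keeps this exponent within
    [l - 2]. *)
Lemma jump_room k : k < 2 ^ (t - 2) -> jump K k <= n %/ 4.
Proof.
move=> kt; apply: leq_trans quarter_ge.
have t4 : 2 ^ t = 4 * 2 ^ (t - 2) by rewrite -(expnD 2 2) subnKC //; lia.
have kk : k <= 2 ^ k by apply/ltnW/ltn_expl.
have tt : t - 2 < 2 ^ (t - 2) by apply: ltn_expl.
have tk : 2 ^ t * 2 ^ k + 2 ^ t * 2 ^ k <= 2 ^ (l - 2).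
  rewrite addnn -mul2n -expnD -expnS leq_exp2l //.
  have := leq_pow_loglog.
  have : 2 ^ (t - 2) = 2 * 2 ^ (t - 3) by rewrite -expnS; congr (_ ^ _); lia.
  have : 4 <= 2 ^ (t - 3) by rewrite -[4]/(2 ^ 2) leq_exp2l //; lia.
  lia.
apply: leq_trans tk; rewrite /jump double_K leq_add2l.
by rewrite (leq_trans kk) // leq_pmull // expn_gt0.
Qed.

Lemma pow_room k : k < 2 ^ (t - 2) -> 2 ^ k <= n %/ 4.
Proof.
move=> /jump_room; apply: leq_trans; rewrite /jump double_K.
by rewrite (leq_trans _ (leq_addr _ _)) // leq_pmull // expn_gt0.
Qed.

Lemma edge_bound_le : edge_bound n t <= n %/ 4 * 2 ^ (t - 2).
Proof.
rewrite /edge_bound mulnAC leq_mul2r; apply/orP; right.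
apply: leq_trans (leq_divM (n %/ 4) (2 ^ t)).
rewrite leq_mul2l; apply/orP; right.
have : t < 2 ^ t by apply: ltn_expl.
lia.
Qed.

(** With X = n / (4 * 2^t) >= 1, rounding gives n <= 32 X 2^(t - 2), and t + 1 <= 8 * floor((t -
    2)/2); the product 2^8 is below 2^10. *)
Lemma edge_bound_ge : n * t.+1 <= 2 ^ 10 * edge_bound n t.
Proof.
rewrite /edge_bound -divnMA.
have t4 : 2 ^ t = 4 * 2 ^ (t - 2) by rewrite -(expnD 2 2) subnKC //; lia.
have : t.+1 <= 8 * (t - 2)./2 by lia.
have : 4 * 2 ^ t <= n.
  apply: leq_trans leq_pow_log; rewrite -(expnD 2 2) leq_exp2l //.
  have := leq_pow_loglog; have : t - 2 < 2 ^ (t - 2) by apply: ltn_expl.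
  lia.
have := divn_eq n (4 * 2 ^ t).
have := ltn_mod n (4 * 2 ^ t); rewrite muln_gt0 expn_gt0.
move: (n %/ (4 * 2 ^ t)) (n %% (4 * 2 ^ t)) => X r /= lt_r n_eq le_n le_t.
have n_le : n <= X * 32 * 2 ^ (t - 2).
  have : 0 < X by case: X n_eq => // ?; lia.
  by move: lt_r n_eq le_n; rewrite t4; move: (2 ^ (t - 2)) => T; nia.
apply: leq_trans (leq_mul n_le le_t) _.
have -> : X * 32 * 2 ^ (t - 2) * (8 * (t - 2)./2) =
          2 ^ 8 * (X * 2 ^ (t - 2) * (t - 2)./2) by lia.
by rewrite leq_mul2r leq_exp2l // orbT.
Qed.

Lemma power_difference_graph :
  exists2 E, forall q, q \in pentagram_paths -> avoids n E q
           & edge_bound n t <= #|edges (host n E)|.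
Proof.
pose u (i : 'I_(n %/ 4) * 'I_(2 ^ (t - 2))) : nat := i.1.
pose w (i : 'I_(n %/ 4) * 'I_(2 ^ (t - 2))) := i.1 + 2 ^ i.2.
exists (chords u w).
  move=> q; apply: avoids_power_difference => a b /chordsP[[i k] /= <- <-].
  by exists k.
apply: leq_trans edge_bound_le _.
rewrite -{1}[n %/ 4]card_ord -{1}[2 ^ _]card_ord -card_prod.
apply: card_chords => [[i k]|[i k] [i' k']]; rewrite /u /w /=.
  have pow_gt0 : 0 < 2 ^ k by rewrite expn_gt0.
  by have := pow_room (ltn_ord k); have := ltn_ord i; lia.
move=> /val_inj-> /addnI/eqP; rewrite eqn_exp2l // => /eqP/val_inj-> //.
Qed.

Lemma rich_power_sum : rich_bipartite n (edge_bound n t) power_sum_paths.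
Proof.
exists ('I_(n %/ 4) * 'I_(2 ^ (t - 2)) : finType)%type.
pose u (i : 'I_(n %/ 4) * 'I_(2 ^ (t - 2))) : nat := i.1.
pose w (i : 'I_(n %/ 4) * 'I_(2 ^ (t - 2))) := n - 2 ^ i.2 - i.1.
exists u, w; rewrite /u /w.
have room (i : 'I_(n %/ 4)) (k : 'I_(2 ^ (t - 2))) :
    [/\ i < n %/ 4, 0 < 2 ^ k & 2 ^ k <= n %/ 4].
  by rewrite ltn_ord expn_gt0 pow_room.
split=> [[i k]|[i k] [i' k']|a b /chordsP[[i k] /= <- <-]|q|] /=.
- by have [] := room i k; lia.
- move=> /val_inj-> e; congr (_, _).
  by apply/val_inj/eqP; rewrite -(eqn_exp2l _ _ (isT : 1 < 2));
     have [] := room i' k; have [] := room i' k'; move: e => /=; lia.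
- by have [] := room i k; lia.
- apply: (@avoids_power_sum _ _ (n %/ 2) n) => a b /chordsP[[i k] /= <- <-].
  by have [] := room i k; split; [lia | exists k; lia].
- by rewrite card_prod !card_ord edge_bound_le.
Qed.

Lemma rich_coloured_jump :
  rich_bipartite n (edge_bound n t) coloured_jump_paths.
Proof.
rewrite /edge_bound; have := leq_divM (n %/ 4) (2 ^ t).
have K2 : K = 2 * 2 ^ (t - 2) by rewrite -expnS /K; congr (_ ^ _); lia.
have := @jump_room; have := @leq_expn_half ^~ (t - 2).
move: (n %/ 4 %/ 2 ^ t) (t - 2)./2 (2 ^ (t - 2)) K2 => X L A K2 powL jumpA leX.
pose T : Type := ('I_X * 'I_A * 'I_L)%type.
exists ('I_X * 'I_A * 'I_L : finType)%type.
(* In base 2^t = 2K the low digit of [u] is the colour and the high digit is free. *)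
pose u (i : T) := 2 ^ t * i.1.1 + (i.1.2 + 4 ^ i.2).
exists u, (fun i : T => n %/ 2 + u i + jump K i.1.2).
(* Both summands fit in K / 2 = 2^(t - 2), the first one strictly. *)
have K_lt (i : T) : i.1.2 + 4 ^ i.2 < K.
  have := powL _ (ltn_ord i.2); have := ltn_ord i.1.2; lia.
have digit_lt (i : T) : i.1.2 + 4 ^ i.2 < 2 ^ t.
  by apply: leq_trans (K_lt i) _; rewrite leq_exp2l //; lia.
have u_mod (i : T) : u i %% 2 ^ t = i.1.2 + 4 ^ i.2.
  by rewrite /u mulnC modnMDl modn_small.
have u_div (i : T) : u i %/ 2 ^ t = i.1.1.
  by rewrite /u mulnC divnMDl ?expn_gt0 // divn_small ?addn0.
have u_lt (i : T) : u i < n %/ 4.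
  rewrite (divn_eq (u i) (2 ^ t)) u_div; apply: leq_trans leX.
  apply: (@leq_trans (i.1.1.+1 * 2 ^ t)).
    by rewrite mulSn addnC ltn_add2r ltn_mod expn_gt0.
  by rewrite leq_mul2r ltn_ord orbT.
have room (i : T) := jumpA _ (ltn_ord i.1.2).
split=> [i|i j uij|a b /chordsP[i /= <- <-]|q|] /=.
- by have := u_lt i; have := room i; lia.
(* The jump recovers [k], the high digit the block, and the low digit then gives 4^i. *)
- rewrite uij => /addnI jump_eq; have kk : i.1.2 = j.1.2.
    apply/val_inj/eqP; rewrite eqn_leq -(leq_jump K).
    by rewrite -[X in _ && X](leq_jump K) jump_eq leqnn.
  have xx : i.1.1 = j.1.1 by apply/val_inj; rewrite /= -!u_div uij.
  have : u i %% 2 ^ t = u j %% 2 ^ t by rewrite uij.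
  rewrite !u_mod kk => /addnI/eqP; rewrite eqn_exp2l // => /eqP/val_inj.
  by case: i j kk xx {uij jump_eq} => [[? ?] ?] [[? ?] ?] /= -> -> ->.
- by have := u_lt i; lia.
- apply: (@avoids_coloured_jump K (n %/ 2)) => a b /chordsP[i /= <- <-].
  by exists i.1.2, i.2; rewrite double_K u_mod K_lt.
- by rewrite !card_prod !card_ord.
Qed.

End EdgeCount.

(** * Lower bound on the extremal number *)

Lemma rotation_lt5 s p : all (ltn^~ 5) (rotation s p).
Proof. by rewrite all_map; apply/allP => a _ /=; rewrite ltn_mod. Qed.

Lemma flip_lt5 q : all (ltn^~ 5) (flip q).
Proof. by rewrite all_map; apply/allP => a _ /=; rewrite ltnS leq_subr. Qed.

Lemma avoids_bipartite_free n (E : rel nat) h L q :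
  (forall a b, E a b -> a < h <= b) -> (forall q, q \in L -> avoids n E q) ->
  all (ltn^~ 5) q -> bipartite_free L q -> avoids n E q.
Proof.
move=> bipE avL q5 /or3P[|/avL //|/avL/avoids_rev //].
exact: avoids_inseparable bipE q5.
Qed.

Section PathBound.
Variables (n B : nat) (P : cg_graph 5) (x : 'I_5 -> 'I_5).
Hypothesis Px : path_along P x.

Lemma rich_bipartite_ex L : rich_bipartite n B L ->
  (forall s, s < 5 -> bipartite_free L (rotation s (path_code x))) ->
  B <= ex_cg n P.
Proof.
move=> [I [u [w [uwn inj_uw bip avL leB]]]] free; apply: leq_trans leB _.
apply: leq_trans (card_chords uwn inj_uw) (ex_cg_host Px _) => s s5.
exact: avoids_bipartite_free bip avL (rotation_lt5 _ _) (free s s5).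
Qed.

Lemma rich_bipartite_flip_ex L : rich_bipartite n B L ->
  (forall s, s < 5 -> bipartite_free L (flip (rotation s (path_code x)))) ->
  B <= ex_cg n P.
Proof.
move=> [I [u [w [uwn inj_uw bip avL leB]]]] free; apply: leq_trans leB _.
pose u' i := n.-1 - w i; pose w' i := n.-1 - u i.
have uwn' i : u' i < w' i < n by rewrite /u' /w'; have := uwn i; lia.
have inj' i j : u' i = u' j -> w' i = w' j -> i = j.
  rewrite /u' /w' => wij uij; have := uwn i; have := uwn j => *.
  by apply: inj_uw; lia.
apply: leq_trans (card_chords uwn' inj') (ex_cg_host Px _) => s s5.
apply: avoids_flip uwn (rotation_lt5 _ _) _.
exact: avoids_bipartite_free bip avL (flip_lt5 _) (free s s5).
Qed.

End PathBound.

Lemma path_code_perm (x : 'I_5 -> 'I_5) :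
  injective x -> path_code x \in permutations (iota 0 5).
Proof.
move=> x_inj; rewrite mem_permutations.
have uniq_x : uniq (path_code x).
  by rewrite map_inj_uniq ?enum_uniq // => i j /val_inj/x_inj.
apply: uniq_perm; rewrite ?iota_uniq //.
apply: (uniq_min_size uniq_x _ _).2; last by rewrite size_path_code.
by move=> _ /mapP[i _ ->]; rewrite mem_iota ltn_ord.
Qed.

Lemma ex_cg_path_ge n (P : cg_graph 5) : is_path P -> ~ zigzag_path P ->
  let t := trunc_log 2 (trunc_log 2 n) in
  5 <= t -> n * t.+1 <= 2 ^ 10 * ex_cg n P.
Proof.
move=> [x Px] nzz t t5; apply: leq_trans (edge_bound_ge (erefl t) t5) _.
rewrite leq_mul2l; apply/orP; right.
have := allP classification _ (path_code_perm (proj1 Px)).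
case/orP => [/(zigzag_codeP Px)//|].
have rotP (a : pred (seq nat)) :
    all (fun s => a (rotation s (path_code x))) (iota 0 5) ->
    forall s, s < 5 -> a (rotation s (path_code x)).
  by move=> /allP aP s s5; apply: aP; rewrite mem_iota.
case/hasP=> a; rewrite !inE.
case/or4P=> [|||/orP[]] /eqP-> {a} /rotP free.
- have [E avE /leq_trans] := power_difference_graph (erefl t) t5; apply.
  by apply: ex_cg_host Px _ => s /free/orP[/avE//|/avE/avoids_rev].
- by apply: (rich_bipartite_ex Px (rich_power_sum (erefl t) t5)) => s /free.
- apply: (rich_bipartite_flip_ex Px (rich_power_sum (erefl t) t5)).
  by move=> s /free.
- by apply: (rich_bipartite_ex Px (rich_coloured_jump (erefl t) t5)) => s /free.
- apply: (rich_bipartite_flip_ex Px (rich_coloured_jump (erefl t) t5)).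
  by move=> s /free.
Qed.

(** * Passage to natural logarithms *)

Lemma log_log_unbounded s : exists N, forall n, N <= n ->
  2 ^ s <= trunc_log 2 n /\ s <= trunc_log 2 (trunc_log 2 n).
Proof.
by exists (2 ^ 2 ^ s) => n n_ge; have l_ge : 2 ^ s <= trunc_log 2 n;
   rewrite !trunc_log_max.
Qed.

Import Order.TTheory GRing.Theory Num.Theory.
Local Open Scope classical_set_scope.
Local Open Scope ring_scope.

(** Both bounds are ln(1 + x) <= x, at x = 1 and x = -1/2. *)
Lemma ln2_bounds (R : realType) : 2^-1 <= ln (2 : R) <= 1.
Proof.
apply/andP; split; last first.
  by have := @le_ln1Dx R 1; rewrite -[1 + 1]/(2 : R); apply; lra.
have := @le_ln1Dx R (- 2^-1); have -> : 1 + - 2^-1 = 2^-1 :> R by lra.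
by rewrite lnV ?posrE //; move=> /(_ ltac:(lra)); lra.
Qed.

Lemma ln_natr_le (R : realType) m : (0 < m)%N ->
  ln (m%:R : R) <= (trunc_log 2 m).+1%:R.
Proof.
move=> m0; have m_lt := ltnW (trunc_log_ltn m (isT : (1 < 2)%N)).
apply: le_trans (_ : ln ((2 ^ (trunc_log 2 m).+1)%:R : R) <= _).
  by rewrite ler_ln ?posrE ?ltr0n ?expn_gt0 // ler_nat.
rewrite natrX lnXn ?ltr0n // -[X in X <= _]mulr_natl ler_piMr //.
by have /andP[] := ln2_bounds R.
Qed.

Theorem theorem3p4 (R : realType) (P : cg_graph 5)
    (P_path : is_path P) (P_not_zigzag : ~ zigzag_path P) :
  (fun n : nat => (ex_cg n P)%:R : R)
    =Omega_\oo (fun n : nat => n%:R * ln (ln n%:R) : R).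
Proof.
rewrite eqOmegaE qualifE; apply/asboolP.
exists ((2 ^ 10)%:R^-1); first by rewrite invr_gt0 ltr0n expn_gt0.
have [N N_large] := log_log_unbounded 5; exists N => // n /= /N_large.
set l := trunc_log 2 n; set t := trunc_log 2 l => -[l_ge t_ge].
have log_gt0 : (0 < l)%N by apply: leq_trans l_ge.
have n_gt0 : (0 < n)%N by move: log_gt0; rewrite /l; case: (n).
(* ln n <= l + 1, and l < 2^(t + 1). *)
have ln_le : ln (n%:R : R) <= (2 ^ t.+1)%:R.
  by apply: le_trans (ln_natr_le R n_gt0) _; rewrite ler_nat trunc_log_ltn.
(* This makes ln ln n nonnegative, which removes the norms; n >= 4 suffices. *)
have ln_ge : 1 <= ln (n%:R : R).
  apply: le_trans (_ : ln ((2 ^ 2)%:R) <= _); last first.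
    rewrite ler_ln ?posrE ?ltr0n ?expn_gt0 // ler_nat.
    apply: leq_trans (trunc_logP (isT : (1 < 2)%N) n_gt0).
    by rewrite leq_exp2l // (leq_trans _ l_ge).
  rewrite natrX lnXn ?ltr0n // mulr2n.
  by have /andP[] := ln2_bounds R; lra.
have lnln_le : ln (ln (n%:R : R)) <= t.+1%:R.
  apply: le_trans (_ : ln ((2 ^ t.+1)%:R : R) <= _).
    by rewrite ler_ln ?posrE ?ltr0n ?expn_gt0 //; lra.
  rewrite natrX lnXn ?ltr0n // -[X in X <= _]mulr_natl ler_piMr //.
  by have /andP[] := ln2_bounds R.
rewrite ger0_norm ?mulr_ge0 ?ln_ge0 // ger0_norm //.
rewrite ler_pdivrMl ?ltr0n ?expn_gt0 //.
apply: le_trans (ler_wpM2l _ lnln_le) _ => //.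
by rewrite -!natrM ler_nat ex_cg_path_ge.
Qed.
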